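(* Fix $0<p<1$, and consider the double random process in which $d_0=0$ and, independently for each $i>0$, $d_i=1$ with probability $p$ and $d_i=0$ otherwise. The process almost surely generates infinitely many copies of $\omega$-trees; that is, almost surely the generated graph is a disjoint union of countably infinitely many components, each of which is an $\omega$-tree.
   Context: Double random process: first the random sequence $\{d_n\}_{n=0}^\infty$ is chosen. Then, given the sequence, a random graph on the vertex set $\{v_0,v_1,v_2,\ldots\}$ is generated as follows. In round $i=0,1,2,\ldots$, independently of the other rounds, a subset $A\subseteq\{v_0,\ldots,v_{i-1}\}$ of cardinality $d_i$ is chosen uniformly at random among all subsets of that cardinality, and $v_i$ is joined by an edge to every vertex of $A$. The $\omega$-tree is the unique countably infinite tree in which every vertex has infinite degree. *)

(* Defs.v *)
From HB Require Import structures.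
From mathcomp Require Import all_boot all_order all_algebra finmap.
From mathcomp Require Import all_classical all_reals all_analysis.
Set Implicit Arguments.
Unset Strict Implicit.
Unset Printing Implicit Defensive.
Import Order.TTheory GRing.Theory Num.Theory.
Local Open Scope classical_set_scope.
Local Open Scope ring_scope.

(** * Graphs

    The edge relation of a graph is a symmetric irreflexive [e : rel T];
    a subgraph induced on [V] is the pair of [V] and [induced e V]. *)
Section Graphs.
Context {T : choiceType}.
Implicit Types (e : rel T) (V : set T).

Definition induced e V : rel T :=
  fun x y => [&& x \in V, y \in V & e x y].

Definition reachable e (x y : T) : Prop :=
  exists2 s : seq T, path e x s & last x s = y.

Definition component e (x : T) : set T := [set y | reachable e x y].

Definition components e : set (set T) := range (component e).

Definition connected_on e V : Prop :=
  V !=set0 /\ forall x y, V x -> V y -> reachable (induced e V) x y.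

(* [ucycle] is a closed walk without repeated vertices. For a symmetric
   irreflexive relation, a single edge is a [ucycle] of size 2, so graph-theoretic
   cycles are those of size at least 3. *)
Definition acyclic e : Prop := forall c : seq T, ucycle e c -> (size c <= 2)%N.

Definition is_tree e V : Prop := connected_on e V /\ acyclic (induced e V).

Definition is_omega_tree e V : Prop :=
  [/\ is_tree e V,
      (V #= [set: nat])%card &
      forall x, V x -> infinite_set [set y | induced e V x y]].

End Graphs.

(** * The double random process

    The vertex [v_i] is the natural number [i], and a subset of
    [{v_0, ..., v_(i-1)}] is an element of [{set 'I_i}]. *)
Section Process.
Context {disp : measure_display} {Omega : measurableType disp} {R : realType}.
Variable P : probability Omega R.

Definition mutually_independent (I : set nat) (d : nat -> {RV P >-> nat}) : Prop :=
  forall (J : {fset nat}) (E : nat -> set nat),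
    [set` J] `<=` I -> (forall i, measurable (E i)) ->
    (P (\bigcap_(i in [set` J]) (d i @^-1` E i)) =
     \prod_(i <- J) P (d i @^-1` E i))%E.

Definition sigma_generated_by (d : nat -> {RV P >-> nat}) : set (set Omega) :=
  <<s [set F | exists i (E : set nat), measurable E /\ F = d i @^-1` E] >>.

(* For [i < k] there is no [B] with [#|B| = k], so the value is always [0]. *)
Definition uniform_subset_prob (i k : nat) (B : {set 'I_i}) : R :=
  if #|B| == k then ('C(i, k)%:R)^-1 else 0.

(* [A i] is the set of earlier vertices to which [v_i] is joined in round [i].
   The second clause says that, conditionally on the sigma-algebra generated by
   the whole sequence [d], the sets [A i] are independent and [A i] is uniform
   among the subsets of cardinality [d i]; it forces [#|A i| = d i], and hence
   [d i <= i], almost surely. *)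
Definition double_random_process (d : nat -> {RV P >-> nat})
    (A : forall i, Omega -> {set 'I_i}) : Prop :=
  (forall i (B : {set 'I_i}), measurable (A i @^-1` [set B])) /\
  forall (n : nat) (B : forall i, {set 'I_i}) (F : set Omega),
    sigma_generated_by d F ->
    (P (F `&` [set w | forall i, (i < n)%N -> A i w = B i]) =
     \int[P]_(w in F) (\prod_(i < n) uniform_subset_prob (d i w) (B i))%:E)%E.

End Process.

Definition process_graph {Omega : Type} (A : forall i, Omega -> {set 'I_i})
    (w : Omega) : rel nat :=
  fun x y => [exists k in A y w, nat_of_ord k == x]
          || [exists k in A x w, nat_of_ord k == y].

(* Main.v *)
Require Import Defs.
From HB Require Import structures.
From mathcomp Require Import all_boot all_order all_algebra finmap.
From mathcomp Require Import all_classical all_reals all_analysis.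
Set Implicit Arguments.
Unset Strict Implicit.
Unset Printing Implicit Defensive.
Import Order.TTheory GRing.Theory Num.Theory.
Local Open Scope classical_set_scope.
Local Open Scope ring_scope.

(** Almost surely every [d i] is 0 or 1. Then every vertex is joined to at most
    one earlier vertex, its parent, and every component is a tree with exactly
    one root, a vertex that chose the empty set. Such a graph is determined by
    its parent map, and it is a disjoint union of infinitely many omega-trees as
    soon as there are infinitely many roots and every vertex is the parent of
    infinitely many others ([omega_forest_parent_graph]). This part involves no
    probability.

    Integrating the conditional law of the rounds over the independent degrees
    shows that the sets [A i] are themselves independent ([rounds_prob]): for
    [i > 0], [A i] is empty with probability [1 - p] and is any given singleton
    with probability [p / i]. The series of the constants [1 - p] and, for a fixed
    vertex [k], the series of the [p / i] both diverge, the latter because it is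
    harmonic. By the second Borel-Cantelli lemma ([second_borel_cantelli]),
    almost surely infinitely many vertices are roots and, for each of the
    countably many [k], infinitely many vertices choose [k] as their parent. *)

(** * Forests given by a parent map *)

(** Roots are encoded as the fixed points of [f]; the condition [x != y] keeps
    them from carrying loops. *)
Definition parent_graph (f : nat -> nat) : rel nat :=
  fun x y => (x != y) && ((f x == y) || (f y == x)).

Section ParentGraph.
Context {f : nat -> nat} (f_le : forall x, (f x <= x)%N).
Implicit Types (x y : nat) (C : set nat).
Local Notation e := (parent_graph f).

(** Each step towards the root strictly decreases the vertex, so [x] steps from
    [x] are always enough, and further ones stay at the root. *)
Definition root_of x : nat := iter x f x.

Lemma root_of_fix r : f r = r -> root_of r = r.
Proof. by move=> fr; apply: iter_fix. Qed.

Lemma iter_parent_le n x :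
  f (iter n f x) = iter n f x \/ (iter n f x + n <= x)%N.
Proof.
elim: n => [|n [IH|IH]] /=; first by right; rewrite addn0.
  by left; rewrite IH.
have := f_le (iter n f x); rewrite leq_eqVlt => /orP[/eqP E|lt].
  by left; rewrite E.
by right; rewrite addnS -addSn (leq_trans _ IH)// leq_add2r.
Qed.

Lemma root_ofP x : f (root_of x) = root_of x.
Proof.
case: (iter_parent_le x x) => // le; apply/eqP; rewrite eqn_leq f_le /root_of.
by move: le; rewrite -[leqRHS]add0n leq_add2r leqn0 => /eqP ->.
Qed.

Lemma root_of_parent x : root_of (f x) = root_of x.
Proof.
have fxK : iter x f (f x) = root_of x by rewrite -iterSr /= root_ofP.
have := iterD (x - f x) (f x) f (f x); rewrite subnK// fxK => ->.
by rewrite iter_fix//; exact: root_ofP.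
Qed.

Lemma root_of_adj x y : e x y -> root_of x = root_of y.
Proof.
by case/andP=> _ /orP[] /eqP <-; rewrite root_of_parent.
Qed.

Lemma parent_graph_sym x y : e x y = e y x.
Proof. by rewrite /parent_graph eq_sym orbC. Qed.

Lemma reachable_root x : reachable e x (root_of x).
Proof.
rewrite /root_of; elim: {2}x => [|n [s es ls]] /=; first by exists [::].
have [fix_n|nfix] := eqVneq (f (iter n f x)) (iter n f x).
  by exists s; rewrite ?fix_n.
exists (rcons s (f (iter n f x))); last by rewrite last_rcons.
by rewrite rcons_path es ls /parent_graph eq_sym nfix eqxx.
Qed.

Lemma reachable_sym x y : reachable e x y -> reachable e y x.
Proof.
case=> s es <-; exists (rev (belast x s)); last first.
  by case: s {es} => //= a s; rewrite rev_cons last_rcons.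
rewrite rev_path; congr is_true: es; apply: eq_path => a b; exact: parent_graph_sym.
Qed.

Lemma reachable_trans x y z :
  reachable e x y -> reachable e y z -> reachable e x z.
Proof.
case=> s es <- [t et <-]; exists (s ++ t); last by rewrite last_cat.
by rewrite cat_path es.
Qed.

(** [root_of] is constant along edges and every vertex reaches its root, so the
    root is a complete invariant of the component. *)
Lemma reachableE x y : reachable e x y <-> root_of x = root_of y.
Proof.
split=> [[s]|rxy]; last first.
  apply: reachable_trans (reachable_root x) _; rewrite rxy.
  exact/reachable_sym/reachable_root.
elim: s x => [|a s IH] x /=; first by move=> _ ->.
by move=> /andP[/root_of_adj -> /IH]; apply.
Qed.

Lemma reachable_induced C x y :
  (forall a b, e a b -> C a -> C b) ->
  C x -> reachable e x y ->
  reachable (Defs.induced e C) x y.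
Proof.
move=> Ccl Cx [s es <-]; exists s => //.
elim: s x Cx es => //= a s IH x Cx /andP[exa es].
have Ca := Ccl _ _ exa Cx.
by rewrite /Defs.induced exa !mem_set//=; apply: IH.
Qed.

Lemma seq_maximum (c : seq nat) : (0 < size c)%N ->
  exists2 m, m \in c & forall x, x \in c -> (x <= m)%N.
Proof.
case: c => // a s _; elim: s a => [|b s IH] a.
  by exists a => [|x]; rewrite inE // => /eqP ->.
have [m ms le_m] := IH b.
have [am|/ltnW ma] := leqP a m.
  by exists m => [|x]; rewrite inE ?ms ?orbT// => /orP[/eqP ->|/le_m].
exists a => [|x]; rewrite inE ?eqxx// => /orP[/eqP ->//|/le_m xm].
exact: leq_trans ma.
Qed.

(** The largest vertex of a cycle has two smaller neighbours on it, which both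
    are its parent and therefore coincide. *)
Lemma acyclic_parent_graph : acyclic e.
Proof.
move=> c /andP[cyc uniq_c]; rewrite leqNgt; apply/negP => size_c.
have c0 : (0 < size c)%N by apply: leq_trans size_c.
have [m mc le_m] := seq_maximum c0.
(* Rotate the cycle so that its maximum comes first. *)
have [i s rot_c] := rot_to mc.
have mem_s x : x \in c = (x \in m :: s) by rewrite -(mem_rot i) rot_c.
move: cyc uniq_c size_c.
rewrite -(rot_cycle i) -(rot_uniq i) -(size_rot i) rot_c.
have up x : x \in m :: s -> e m x -> f m = x.
  rewrite -mem_s => /le_m xm /andP[nmx /orP[/eqP //|/eqP fx]].
  by move: nmx; rewrite eqn_leq xm andbT -{1}fx f_le.
case: s {rot_c mem_s} up => // a s; elim/last_ind: s => // s b _ up.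
rewrite /= rcons_path last_rcons => /andP[ema /andP[_ ebm]] /andP[_ /andP[anb _]] _.
move: anb; rewrite mem_rcons inE.
rewrite -(up a) ?inE ?eqxx ?orbT// -(up b) ?eqxx//.
  by rewrite !inE mem_rcons inE eqxx !orbT.
by rewrite parent_graph_sym.
Qed.

Lemma acyclic_induced (T : choiceType) (e' : rel T) V :
  acyclic e' -> acyclic (Defs.induced e' V).
Proof.
move=> ac c /andP[cyc uc]; apply: ac; rewrite /ucycle uc andbT.
by apply: sub_cycle cyc => a b /and3P[].
Qed.

Lemma unbounded_infinite (V : set nat) :
  (forall m, exists2 x, V x & (m <= x)%N) -> infinite_set V.
Proof.
move=> ub /finite_fsetP[X VX].
have [x Vx] := ub (\max_(y <- X) y).+1.
apply/negP; rewrite -leqNgt; apply: leq_bigmax_seq => //.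
by move: Vx; rewrite VX.
Qed.

Lemma card_infinite_nat (V : set nat) : infinite_set V -> (V #= [set: nat])%card.
Proof. by move=> Vinf; apply: eq_card_nat. Qed.

Theorem omega_forest_parent_graph :
  (forall m, exists2 r, f r = r & (m <= r)%N) ->
  (forall x m, exists2 y, f y = x & (m <= y)%N) ->
  (components e #= [set: nat])%card /\
  forall C, components e C -> is_omega_tree e C.
Proof.
move=> roots children; split.
  (* The components correspond bijectively to the roots. *)
  have -> : components e = component e @` [set r | f r = r].
    apply/seteqP; split=> [_ [x _ <-]|_ [r _ <-]]; last by exists r.
    exists (root_of x); first exact: root_ofP.
    by apply/seteqP; split=> y; rewrite /component/= !reachableE
      (root_of_fix (root_ofP x)).
  apply: (@card_eq_trans _ _ _ _ [set r | f r = r]).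
    apply: inj_card_eq => r r' /set_mem/= fr /set_mem/= fr' /(congr1 (@^~ r')).
    rewrite /component/= => rr'.
    have /reachableE : reachable e r r' by rewrite rr'; exact/reachableE.
    by rewrite !root_of_fix.
  exact/card_infinite_nat/unbounded_infinite.
move=> _ [x0 _ <-]; set C := component e x0.
have Ccl a b : e a b -> C a -> C b.
  by rewrite /C/component/= !reachableE => /root_of_adj <-.
have deg x : C x -> infinite_set [set y | Defs.induced e C x y].
  move=> Cx; apply: unbounded_infinite => m.
  have [y fy my] := children x (maxn m x.+1).
  rewrite geq_max in my; case/andP: my => my xy.
  have exy : e x y by rewrite /parent_graph neq_ltn xy fy eqxx orbT.
  by exists y => //; rewrite /= /Defs.induced exy !mem_set//; exact: Ccl Cx.
have Cx0 : C x0 by apply/reachableE.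
split=> //.
- split; last exact/acyclic_induced/acyclic_parent_graph.
  split; first by exists x0.
  move=> x y Cx Cy; apply: reachable_induced => //.
  apply/reachableE; move: Cx Cy.
  by rewrite /C/component/= !reachableE => <- <-.
- apply: card_infinite_nat; apply: sub_infinite_set (deg _ Cx0).
  by move=> y /= /and3P[_ /set_mem].
Qed.

End ParentGraph.

(** * Independent discrete rounds *)

Lemma measurable_forall (disp : measure_display) (Omega : measurableType disp)
    (D : pred nat) (F : nat -> set Omega) :
  (forall i, measurable (F i)) -> measurable [set w | forall i, D i -> F i w].
Proof.
move=> mF.
rewrite (_ : [set _ | _] = \bigcap_i (if D i then F i else setT)); last first.
  apply/seteqP; split=> w Fw i; first by case: ifP => // /Fw.
  by move=> Di; have := Fw i I; rewrite Di.
by apply: bigcapT_measurable => i; case: ifP.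
Qed.

Section IndependentRounds.
Context {disp : measure_display} {Omega : measurableType disp} {R : realType}.
Context (P : probability Omega R).
Context {T : nat -> finType} (X : forall i, Omega -> T i).
Context (q : forall i, T i -> R) (x0 : forall i, T i).
Context (measurable_round : forall i y, measurable (X i @^-1` [set y])).
Context (cylinder_prob : forall n (x : forall i, T i),
  P [set w | forall i, (i < n)%N -> X i w = x i] = (\prod_(i < n) q (x i))%:E).

Let weight i (S : {set T i}) : R := \sum_(y in S) q y.

Definition box n (S : forall i, {set T i}) : set Omega :=
  [set w | forall i, (i < n)%N -> X i w \in S i].

Lemma measurable_round_in i (S : {set T i}) : measurable [set w | X i w \in S].
Proof.
rewrite (_ : [set _ | _] = \bigcup_(y in [set` S]) (X i @^-1` [set y])).
  by apply: fin_bigcup_measurable.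
by apply/seteqP; split=> [w Sw|w [y Sy /= ->]//]; exists (X i w).
Qed.

Lemma measurable_box n S : measurable (box n S).
Proof.
apply: (measurable_forall _ (F := fun i => [set w | X i w \in S i])) => i.
exact: measurable_round_in.
Qed.

(** Cylinders are the boxes all of whose sides are singletons. The induction on
    [k] frees one side at a time: a box is the disjoint union over [y] in its
    [k]-th side of the boxes with that side replaced by [y], and the product of
    the weights distributes over this sum. *)
Lemma box_prob_partial n k (x : forall i, T i) (S : forall i, {set T i}) :
  (k <= n)%N -> (forall i, (k <= i)%N -> S i = [set x i]%SET) ->
  P (box n S) = (\prod_(i < n) weight (S i))%:E.
Proof.
elim: k x S => [|k IH] x S kn Sx.
  under eq_bigr => i _ do rewrite /weight Sx// big_set1.
  rewrite -cylinder_prob; congr (P _); apply/seteqP; split=> w wS i /wS;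
    by rewrite Sx// inE => /eqP.
pose S' y : forall i, {set T i} := dfwith S k [set y]%SET.
have S'k y : S' y k = [set y]%SET by rewrite /S' dfwithin.
have S'i y i : k != i -> S' y i = S i by move=> ki; rewrite /S' dfwithout.
have S'P y : P (box n (S' y)) = (\prod_(i < n) weight (S' y i))%:E.
  apply: (IH (dfwith x k y)) => [|i]; first exact: ltnW.
  rewrite leq_eqVlt => /orP[/eqP <-|ki]; first by rewrite S'k dfwithin.
  by rewrite S'i ?dfwithout ?Sx// neq_ltn ki.
rewrite (_ : box n S = \bigcup_(y in [set` S k]) box n (S' y)); last first.
  apply/seteqP; split=> [w Sw|w [y Sy Sw] i ni].
    exists (X k w) => [|i ni]; first exact: Sw.
    have [<-|ki] := eqVneq k i; first by rewrite S'k inE.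
    by rewrite S'i// Sw.
  have := Sw i ni; have [<-|ki] := eqVneq k i; last by rewrite S'i.
  by rewrite S'k inE => /eqP ->.
rewrite measure_fin_bigcup//; last first.
- by move=> *; exact: measurable_box.
- move=> y z _ _ [w [/(_ k kn) + /(_ k kn)]].
  by rewrite !S'k !inE => /eqP <- /eqP.
- rewrite (_ : [set` S k] = [set` enum (S k)]); last first.
    by apply/seteqP; split=> y /=; rewrite mem_enum.
  rewrite -fsbig_seq ?enum_uniq// big_enum/=.
  under eq_bigr => y _ do rewrite S'P.
  rewrite sumEFin; congr (_%:E).
  rewrite (bigD1 (Ordinal kn))//= {1}/weight mulr_suml; apply: eq_bigr => y _.
  rewrite (bigD1 (Ordinal kn))//= S'k /weight big_set1; congr (_ * _).
  by apply: eq_bigr => i; rewrite -val_eqE/= eq_sym => /S'i ->.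
Qed.

Lemma box_prob n (S : forall i, {set T i}) :
  P (box n S) = (\prod_(i < n) weight (S i))%:E.
Proof.
pose S' i := if (i < n)%N then S i else [set x0 i]%SET.
have S'S i : (i < n)%N -> S' i = S i by rewrite /S' => ->.
rewrite (_ : box n S = box n S'); last first.
  by apply/seteqP; split=> w Sw i ni; have := Sw i ni; rewrite S'S.
rewrite (@box_prob_partial n n x0)// => [|i]; last by rewrite /S' ltnNge => ->.
by congr (_%:E); apply: eq_bigr => i _; rewrite S'S.
Qed.

(** The normalisation of [q] follows from the product formula alone: the box with
    full sides has probability 1 for every number of rounds, so each new factor
    is 1. *)
Lemma weightT i : weight [set: T i] = 1.
Proof.
have prodT n : \prod_(i < n) weight [set: T i] = 1.
  apply: EFin_inj; rewrite -(box_prob n (fun i => [set: T i]%SET)).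
  rewrite -(probability_setT P); congr (P _).
  by apply/seteqP; split=> // w _ j _; rewrite inE.
by have := prodT i.+1; rewrite big_ord_recr/= prodT mul1r.
Qed.

Lemma round_prob i (S : {set T i}) : P [set w | X i w \in S] = (weight S)%:E.
Proof.
pose S' : forall i, {set T i} := dfwith (fun i => [set: T i]%SET) i S.
have S'i : S' i = S by rewrite /S' dfwithin.
have S'j j : i != j -> S' j = [set: T j]%SET by move=> ij;
  rewrite /S' dfwithout.
rewrite (_ : [set _ | _] = box i.+1 S'); last first.
  apply/seteqP; split=> [w Sw j _|w /(_ i (ltnSn i))]; last by rewrite S'i.
  have [<-|ij] := eqVneq i j; first by rewrite S'i.
  by rewrite S'j// inE.
rewrite box_prob big_ord_recr/= S'i big1 ?mul1r// => j _.
by rewrite S'j ?weightT// neq_ltn ltn_ord orbT.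
Qed.

Lemma weight_ge0 i (S : {set T i}) : 0 <= weight S.
Proof. by rewrite -lee_fin -round_prob. Qed.

Lemma weightC i (S : {set T i}) : weight (~: S)%SET = 1 - weight S.
Proof.
rewrite -(weightT i) /weight [in RHS](big_setID S)/=.
by rewrite finset.setTI finset.setTD [in RHS]addrC addrK.
Qed.

(** By independence the target sets are all missed from round [m] to round
    [n - 1] with probability [\prod (1 - weight (S i))], which is at most
    [expR (- \sum weight (S i))] and hence arbitrarily small. *)
Lemma second_borel_cantelli (S : forall i, {set T i}) :
  (forall m M, exists n, M <= \sum_(m <= i < n) weight (S i)) ->
  {ae P, forall w m, exists2 i, (m <= i)%N & X i w \in S i}.
Proof.
move=> divS; apply: ae_foralln => m.
pose N := [set w | forall i, (m <= i)%N -> X i w \in (~: S i)%SET].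
have NE : ~` [set w | exists2 i, (m <= i)%N & X i w \in S i] = N.
  apply/seteqP; split=> w.
    by move=> nS i mi; rewrite inE; apply/negP => Si; apply: nS; exists i.
  by move=> Nw [i /Nw + Si]; rewrite inE Si.
have mN : measurable N.
  apply: (measurable_forall _
    (F := fun i => [set w | X i w \in (~: S i)%SET])).
  by move=> i; exact: measurable_round_in.
suff PN0 : P N = 0%E.
  by suff : P.-negligible N; [rewrite -NE|exact/negligibleP].
have PNfin : (P N : \bar R) \is a fin_num by exact: fin_num_measure.
rewrite -(fineK PNfin); set r := fine (P N).
have r0 : 0 <= r by exact: fine_ge0.
have bound n : r <= expR (- \sum_(m <= i < n) weight (S i)).
  pose S' i := if (m <= i)%N then (~: S i)%SET else [set: T i]%SET.
  have : (P N <= P (box n S'))%E.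
    apply: le_measure; rewrite ?inE//; first exact: measurable_box.
    move=> w Nw i ni; rewrite /S'; case: leqP => [mi|_]; last by rewrite inE.
    exact: Nw.
  rewrite -(fineK PNfin) box_prob lee_fin => /le_trans; apply.
  rewrite -sumrN big_geq_mkord/= expR_sum [leRHS]big_mkcond/=.
  apply: ler_prod => i _; rewrite weight_ge0/= /S'; case: leqP => mi.
    by rewrite weightC; exact: expR_ge1Dx.
  by rewrite weightT.
apply/eqP; rewrite eqe eq_le r0 andbT leNgt; apply/negP => r_gt0.
(* Then [r <= expR (- r^-1)] contradicts [1 + r^-1 <= expR r^-1]. *)
have [n] := divS m r^-1.
have := bound n; set s := \sum_(_ <= _ < _) _ => rs ls.
have: r * expR s <= 1 by rewrite -ler_pdivlMr ?expR_gt0// div1r -expRN.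
apply/negP; rewrite -ltNge.
have : r * (1 + s) <= r * expR s by rewrite ler_wpM2l// expR_ge1Dx.
apply: lt_le_trans; rewrite mulrDr mulr1.
have : 1 <= r * s by rewrite -(mulfV (lt0r_neq0 r_gt0)) ler_wpM2l.
by move=> ?; rewrite -[ltLHS]add0r ltr_leD.
Qed.

End IndependentRounds.

(** * The law of the parent sets *)

(** Comparison with the harmonic series. *)
Lemma divergent_tail (R : realType) (u : nat -> R) (c : R) (k : nat) :
  (forall i, 0 <= u i) -> 0 < c -> (forall i, (k <= i)%N -> c * harmonic i <= u i) ->
  forall m M, exists n, M <= \sum_(m <= i < n) u i.
Proof.
move=> u0 c0 cu m M; apply: contrapT => nM; apply: (@dvg_harmonic R).
have hnd : nondecreasing_seq (series (@harmonic R)).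
  by apply: nondecreasing_series => i _ _; exact: harmonic_ge0.
apply: nondecreasing_is_cvgn => //.
pose l := maxn m k.
exists (series (@harmonic R) l + M / c) => _ [n _ <-].
apply: (le_trans (hnd _ (n + l)%N (leq_addr _ _))).
rewrite /series/= (big_cat_nat (n := l))//=; last exact: leq_addl.
rewrite lerD2l ler_pdivlMr// mulrC mulr_sumr.
have uM : \sum_(m <= i < n + l) u i <= M.
  by rewrite leNgt; apply/negP => /ltW Mu; apply: nM; exists (n + l)%N.
apply: le_trans uM; rewrite [leRHS](big_cat_nat (n := l))//=; last 2 first.
- exact: leq_maxl.
- exact: leq_addl.
rewrite -[leLHS]add0r lerD ?sumr_ge0//.
by apply: ler_sum_nat => i /andP[li _]; apply: cu; rewrite (leq_trans _ li)// leq_maxr.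
Qed.

Section DoubleRandomProcess.
Context {disp : measure_display} {Omega : measurableType disp} {R : realType}.
Context (P : probability Omega R).
Context (d : nat -> {RV P >-> nat}) (A : forall i : nat, Omega -> {set 'I_i}).
Context (d0 : forall w, d 0%N w = 0%N).
Context (d_indep : mutually_independent [set i | (0 < i)%N] d).
Context (drpA : double_random_process d A).

Definition degree_prob i k : R := fine (P (d i @^-1` [set k])).

(** The unconditional law of [A i]: the degree is drawn first, then a subset of
    that size. *)
Definition round_law i (B : {set 'I_i}) : R :=
  'C(i, #|B|)%:R^-1 * degree_prob i #|B|.

Lemma round_law_ge0 i (B : {set 'I_i}) : 0 <= round_law B.
Proof. by rewrite mulr_ge0 ?invr_ge0 ?ler0n// fine_ge0. Qed.

Lemma measurable_degree i E : measurable (d i @^-1` E).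
Proof. exact: measurable_funPTI. Qed.

Lemma degree_probE i k : P (d i @^-1` [set k]) = (degree_prob i k)%:E.
Proof.
by rewrite /degree_prob fineK// fin_num_measure//; exact: measurable_degree.
Qed.

(** Independence is only assumed for positive indices; the constant [d 0]
    contributes a factor 1. *)
Lemma degrees_prob n (k : nat -> nat) :
  k 0%N = 0%N ->
  P [set w | forall i, (i < n)%N -> d i w = k i] =
  (\prod_(i < n) degree_prob i (k i))%:E.
Proof.
move=> k0; case: n => [|n].
  rewrite big_ord0 -(probability_setT P); congr (P _).
  by apply/seteqP; split.
pose J := [fset i | i in iota 1 n]%fset.
have JE i : (i \in J) = (0 < i < n.+1)%N.
  by rewrite in_fset /= mem_iota add1n.
have -> : [set w | forall i, (i < n.+1)%N -> d i w = k i] =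
    \bigcap_(i in [set` J]) (d i @^-1` [set k i]).
  apply/seteqP; split=> w dw i /=; first by rewrite JE => /andP[_ /dw].
  by case: i => [|i] ni; [rewrite d0 k0|apply: dw; rewrite /= JE].
rewrite (d_indep (E := fun i => [set k i]))//; last first.
  by move=> i /=; rewrite JE => /andP[].
rewrite big_ord_recl/= [degree_prob 0 _](_ : _ = 1) ?mul1r; last first.
  apply: EFin_inj; rewrite -degree_probE -(probability_setT P); congr (P _).
  by apply/seteqP; split=> // w _ /=; rewrite d0 k0.
rewrite (perm_big (iota 1 n)); last first.
  by apply: uniq_perm; rewrite ?fset_uniq ?iota_uniq// => i; rewrite JE mem_iota add1n.
have -> : iota 1 n = index_iota 1 n.+1 by rewrite /index_iota subSS subn0.
rewrite big_add1/= big_mkord.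
rewrite -prodEFin; apply: eq_bigr => i _; exact: degree_probE.
Qed.

(** For prescribed sets [B i] the conditional probability vanishes off the event
    that all degrees are [#|B i|] and is constant on it, so its integral is that
    constant times a probability about the independent degrees. *)
Lemma rounds_prob n (B : forall i, {set 'I_i}) :
  P [set w | forall i, (i < n)%N -> A i w = B i] =
  (\prod_(i < n) round_law (B i))%:E.
Proof.
have [_ /(_ n B setT)] := drpA; rewrite setTI => -> //; last first.
  by apply: sub_sigma_algebra; exists 0%N, setT.
pose c := \prod_(i < n) ('C(i, #|B i|)%:R^-1 : R).
pose E := [set w | forall i, (i < n)%N -> d i w = #|B i|].
have mE : measurable E.
  apply: (measurable_forall _ (F := fun i => d i @^-1` [set #|B i|])) => i.
  exact: measurable_degree.
have integrandE w :
    \prod_(i < n) uniform_subset_prob (d i w) (B i) = c * \1_E w.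
  rewrite indicE; have [Ew|nEw] := boolP (w \in E).
    rewrite mulr1; apply: eq_bigr => i _.
    move: Ew => /set_mem/(_ i (ltn_ord i)) dw.
    by rewrite /uniform_subset_prob dw eqxx.
  rewrite mulr0; apply/eqP; apply/prodf_eq0.
  have : exists i : 'I_n, d i w != #|B i|.
    apply: contrapT => h; move/negP: nEw; apply; apply: mem_set => i ni.
    by apply/eqP/negP => /negP dw; apply: h; exists (Ordinal ni).
  by case=> i dw; exists i => //; rewrite /uniform_subset_prob ifN// eq_sym.
under eq_integral => w _ do rewrite integrandE.
have c0 : 0 <= c by apply: prodr_ge0 => i _; rewrite invr_ge0.
rewrite (integralZl_indic measurableT (fun=> E))//; last by rewrite ltNge c0.
rewrite integral_indic// setIT.
transitivity (c%:E * P E)%E => //.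
rewrite /E (@degrees_prob n (fun i => #|B i|)); last first.
  by apply/eqP; rewrite cards_eq0; apply/eqP/setP => -[].
by rewrite -EFinM -big_split.
Qed.

Section Degrees01.
Context (p : R) (hp0 : 0 < p) (hp1 : p < 1).
Context (hd1 : forall i, (0 < i)%N ->
  P (d i @^-1` [set 1%N]) = p%:E /\ P (d i @^-1` [set 0%N]) = (1 - p)%:E).

Lemma degree_prob1 i : (0 < i)%N -> degree_prob i 1 = p.
Proof. by move=> /hd1[h _]; rewrite /degree_prob h. Qed.

Lemma degree_prob0 i : (0 < i)%N -> degree_prob i 0 = 1 - p.
Proof. by move=> /hd1[_ h]; rewrite /degree_prob h. Qed.

Lemma degree_prob_gt1 i k : (1 < k)%N -> degree_prob i k = 0.
Proof.
move=> k1; apply/eqP; rewrite eq_le fine_ge0// andbT -lee_fin -degree_probE.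
case: i => [|i].
  rewrite (_ : _ @^-1` _ = set0) ?measure0//.
  by apply/seteqP; split=> // w /=; rewrite d0 => k0; rewrite -k0 in k1.
have md k' : measurable (d i.+1 @^-1` [set k']) by exact: measurable_degree.
have dis a b : a != b -> d i.+1 @^-1` [set a] `&` d i.+1 @^-1` [set b] = set0.
  move=> ab; apply/seteqP; split=> // w [/= da db].
  by move: ab; rewrite -da db eqxx.
have : (P (d i.+1 @^-1` [set 0%N]) + P (d i.+1 @^-1` [set 1%N]) +
    P (d i.+1 @^-1` [set k]) <= 1)%E.
  have mU := measurableU _ _ (md 0%N) (md 1%N).
  rewrite -measureU ?dis// -measureU//; last first.
    by rewrite setIUl !dis ?setU0// ltn_eqF// ltnW.
  exact/probability_le1/measurableU.
have [-> ->] := hd1 (ltn0Sn i); rewrite degree_probE -!EFinD !lee_fin subrK.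
by rewrite gerDl.
Qed.

Lemma round_law0 i : (0 < i)%N -> round_law (finset.set0 : {set 'I_i}) = 1 - p.
Proof. by move=> i0; rewrite /round_law cards0 bin0 invr1 mul1r degree_prob0. Qed.

Lemma round_law1 i (k : 'I_i) : round_law [set k]%SET = p / i%:R.
Proof.
rewrite /round_law cards1 bin1 degree_prob1 1?mulrC//.
exact: leq_ltn_trans (ltn_ord k).
Qed.

Lemma round_law_gt1 i (B : {set 'I_i}) : (1 < #|B|)%N -> round_law B = 0.
Proof. by move=> B1; rewrite /round_law degree_prob_gt1// mulr0. Qed.

Lemma ae_infinitely_often (S : forall i, {set {set 'I_i}}) :
  (forall m M, exists n, M <= \sum_(m <= i < n) \sum_(B in S i) round_law B) ->
  {ae P, forall w m, exists2 i, (m <= i)%N & A i w \in S i}.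
Proof.
apply: second_borel_cantelli; first exact: (fun=> finset.set0).
- exact: drpA.1.
- exact: rounds_prob.
Qed.

Lemma ae_at_most_one_parent : {ae P, forall w i, (#|A i w| <= 1)%N}.
Proof.
apply: ae_foralln => i.
pose S := [set B : {set 'I_i} | (1 < #|B|)%N]%SET.
have SE : ~` [set w | (#|A i w| <= 1)%N] = [set w | A i w \in S].
  by apply/seteqP; split=> w /=; rewrite inE ltnNge => /negP.
suff : P.-negligible [set w | A i w \in S] by rewrite -SE.
apply/negligibleP; first exact: (measurable_round_in drpA.1).
transitivity ((\sum_(B in S) round_law B)%:E).
  apply: round_prob; first exact: (fun=> finset.set0).
  - exact: drpA.1.
  - exact: rounds_prob.
by rewrite big1// => B; rewrite inE => /round_law_gt1.
Qed.

Lemma ae_infinitely_many_roots :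
  {ae P, forall w m, exists2 i, (m <= i)%N & A i w = finset.set0}.
Proof.
have := @ae_infinitely_often (fun i => [set finset.set0]%SET).
case=> [m M|N [mN N0 HN]]; last first.
  exists N; split=> //; apply: subset_trans HN => w; apply: contra_not => h m.
  by have [i mi] := h m; rewrite inE => /eqP; exists i.
move: m M; apply: (@divergent_tail _ _ (1 - p) 1).
- by move=> i; apply: sumr_ge0 => *; exact: round_law_ge0.
- by rewrite subr_gt0.
- move=> i i0; rewrite big_set1 round_law0//= ler_piMr ?subr_ge0 ?(ltW hp1)//.
  by rewrite invf_le1// ler1n.
Qed.

Lemma ae_infinitely_many_children :
  {ae P, forall w (k m : nat), exists2 i, (m <= i)%N &
     exists2 j : 'I_i, j = k :> nat & A i w = [set j]%SET}.
Proof.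
apply: ae_foralln => k.
(* For [i <= k] there is no such [j], and the target set is empty. *)
have := @ae_infinitely_often (fun i => [set B |
  [exists j : 'I_i, (j == k :> nat) && (B == [set j]%SET)]]%SET).
case=> [m M|N [mN N0 HN]]; last first.
  exists N; split=> //; apply: subset_trans HN => w; apply: contra_not => h m.
  have [i mi] := h m; rewrite inE => /existsP[j /andP[/eqP jk /eqP Aj]].
  by exists i => //; exists j.
move: m M; apply: (@divergent_tail _ _ p k.+1) => //.
- by move=> i; apply: sumr_ge0 => *; exact: round_law_ge0.
- move=> i ki; rewrite (bigD1 [set Ordinal ki]%SET)/=; last first.
    by rewrite inE; apply/existsP; exists (Ordinal ki); rewrite !eqxx.
  rewrite round_law1 -[leLHS]addr0 lerD ?sumr_ge0// => [|*]; last first.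
    exact: round_law_ge0.
  by rewrite ler_wpM2l ?(ltW hp0)//= lef_pV2 ?posrE ?ltr0n ?ler_nat// (leq_trans _ ki).
Qed.

End Degrees01.
End DoubleRandomProcess.

(** * The process graph as a parent graph *)

(** Meant for sets with at most one element; a round without a parent yields the
    fixed point [i], as the encoding of roots requires. *)
Definition parent i (B : {set 'I_i}) : nat :=
  if [pick k in B] is Some k then val k else i.

Lemma parent_set0 i : parent (finset.set0 : {set 'I_i}) = i.
Proof. by rewrite /parent; case: pickP => // k; rewrite inE. Qed.

Lemma parent_set1 i (k : 'I_i) : parent [set k]%SET = k.
Proof.
rewrite /parent; case: pickP => [j|/(_ k)]; first by rewrite inE => /eqP ->.
by rewrite inE eqxx.
Qed.

Lemma parent_le i (B : {set 'I_i}) : (parent B <= i)%N.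
Proof. by rewrite /parent; case: pickP => // k _; exact/ltnW/ltn_ord. Qed.

Lemma mem_parent i (B : {set 'I_i}) x : (#|B| <= 1)%N ->
  [exists k in B, nat_of_ord k == x] = (x != i) && (parent B == x).
Proof.
rewrite leq_eqVlt ltnS leqn0 => /orP[/cards1P[k ->]|].
  rewrite parent_set1; apply/existsP/andP => [[j]|[_ /eqP <-]].
    by rewrite inE => /andP[/eqP -> /eqP <-]; rewrite neq_ltn ltn_ord eqxx.
  by exists k; rewrite inE !eqxx.
rewrite cards_eq0 => /eqP ->; rewrite parent_set0 [RHS](_ : _ = false).
  by apply/existsP => -[k]; rewrite inE.
by rewrite eq_sym andNb.
Qed.

Lemma process_graph_parent (Omega : Type) (A : forall i, Omega -> {set 'I_i}) w :
  (forall i, (#|A i w| <= 1)%N) ->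
  process_graph A w = parent_graph (fun i => parent (A i w)).
Proof.
move=> A1; apply/funext => x; apply/funext => y.
rewrite /process_graph /parent_graph !mem_parent// [y == x]eq_sym.
by rewrite -andb_orr orbC.
Qed.

Theorem theorem6p12 (disp : measure_display) (Omega : measurableType disp)
    (R : realType) (P : probability Omega R) (p : R)
    (d : nat -> {RV P >-> nat}) (A : forall i : nat, Omega -> {set 'I_i})
    (hp0 : 0 < p) (hp1 : p < 1)
    (hd0 : forall w, d 0%N w = 0%N)
    (hd1 : forall i, (0 < i)%N ->
       P (d i @^-1` [set 1%N]) = p%:E /\ P (d i @^-1` [set 0%N]) = (1 - p)%:E)
    (hdind : mutually_independent [set i | (0 < i)%N] d)
    (hA : double_random_process d A) :
  {ae P, forall w,
     (components (process_graph A w) #= [set: nat])%card /\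
     forall C, components (process_graph A w) C ->
       is_omega_tree (process_graph A w) C}.
Proof.
have at_most_one := ae_at_most_one_parent hd0 hdind hA hd1.
have roots := ae_infinitely_many_roots hd0 hdind hA hp1 hd1.
have children := ae_infinitely_many_children hd0 hdind hA hp0 hd1.
near=> w.
have A1 : forall i, (#|A i w| <= 1)%N by near: w.
have rootsw : forall m, exists2 i, (m <= i)%N & A i w = finset.set0 by near: w.
have childrenw : forall k m : nat, exists2 i, (m <= i)%N &
  exists2 j : 'I_i, j = k :> nat & A i w = [set j]%SET by near: w.
rewrite (process_graph_parent A1); apply: omega_forest_parent_graph.
- by move=> i; exact: parent_le.
- by move=> m; have [i mi Ai] := rootsw m; exists i; rewrite // Ai parent_set0.
- move=> k m; have [i mi [j <- Ai]] := childrenw k m.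
  by exists i; rewrite // Ai parent_set1.
Unshelve. all: by end_near.
Qed.
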